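(* The linear system $$\begin{bmatrix} \dot{I}^m \\ \dot{U}^d \end{bmatrix}=\begin{bmatrix} -D^{-1}(E+YR) & D^{-1}Y \\ -\Psi L \Upsilon^{-1}+\Phi L \Upsilon^{-1} D^{-1}(E+YR) & -\Phi L \Upsilon^{-1}D^{-1}Y \end{bmatrix}\begin{bmatrix} I^m \\ U^d \end{bmatrix}$$ in $\mathbb{R}^{2n}$ is semistable if and only if the matrix second-order system in $\mathbb{R}^n$ $$D\Upsilon\ddot{x}(t)+(\Upsilon+YR\Upsilon+Y\Phi L)\dot{x}(t)+Y\Psi L\,x(t)=0$$ is semistable.
   Context: Network. Let $\mathcal{N}=\{1,\dots,n\}$ be the set of generator nodes of a DC microgrid. Branch conductances $G_{kj}=G_{jk}\ge 0$ ($k\ne j$) and shunt conductances $G_{kk}\ge 0$ are given. The conductance matrix is $Y=[Y_{kj}]=Y_s+Y_c\in\mathbb{R}^{n\times n}$, with $Y_s=\mathrm{diag}(G_{11},\dots,G_{nn})$ and $Y_c$ the symmetric matrix with off-diagonal entries $-G_{kj}$ and diagonal entries $\sum_{j\ne k}G_{kj}$. Information graph Laplacian. $L=(l_{ij})\in\mathbb{R}^{n\times n}$ has, for $i\neq j$, $l_{ij}=-1$ if $Y_{ij}\ne 0$ and $l_{ij}=0$ otherwise, and $l_{ii}=-\sum_{j\ne i}l_{ij}$. Parameters. $E$ is the identity matrix; $D=\mathrm{diag}(\tau_1,\dots,\tau_n)$ with filter time constants $\tau_k>0$; $R=\mathrm{diag}(R_1,\dots,R_n)$ with virtual resistances $R_k>0$;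 $\Upsilon=\mathrm{diag}(I_1^{max},\dots,I_n^{max})$ with maximum currents $I_k^{max}>0$; $\Phi=\mathrm{diag}(\alpha_1,\dots,\alpha_n)$, $\alpha_k>0$; $\Psi=\mathrm{diag}(\beta_1,\dots,\beta_n)$, $\beta_k>0$ (proportional and integral gains). $I^m\in\mathbb{R}^n$ is the vector of measured (filtered) currents and $U^d\in\mathbb{R}^n$ the vector of rated output voltages. Semistability. A linear system $\dot z=Az$ is semistable if $\lim_{t\to\infty}z(t)$ exists for every initial condition $z(0)$. A second-order system is semistable if its state $(x(t),\dot x(t))$ converges as $t\to\infty$ for all initial conditions $(x(0),\dot x(0))$. *)

(* Defs.v *)
From HB Require Import structures.
From mathcomp Require Export all_boot all_order all_algebra.
From mathcomp Require Export all_classical all_reals all_analysis.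

Set Implicit Arguments.
Unset Strict Implicit.
Unset Printing Implicit Defensive.

Export Order.TTheory GRing.Theory Num.Theory.
Export numFieldNormedType.Exports.

Local Open Scope ring_scope.
Local Open Scope classical_set_scope.

(* In a conductance array G, the entry G k j with k != j is the conductance of
   the branch between k and j, whereas the diagonal entry G k k is the shunt
   conductance at k. *)
Definition shunt_mx (R : realType) (n : nat) (G : 'M[R]_n) : 'M[R]_n :=
  diag_mx (\row_k G k k).

Definition branch_mx (R : realType) (n : nat) (G : 'M[R]_n) : 'M[R]_n :=
  \matrix_(k, j) if k == j then \sum_(i | i != k) G k i else - G k j.

Definition conductance_mx (R : realType) (n : nat) (G : 'M[R]_n) : 'M[R]_n :=
  shunt_mx G + branch_mx G.

Definition info_offdiag (R : realType) (n : nat) (Y : 'M[R]_n)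
  (i j : 'I_n) : R := if Y i j != 0 then -1 else 0.

Definition info_laplacian (R : realType) (n : nat) (Y : 'M[R]_n) : 'M[R]_n :=
  \matrix_(i, j) if i == j then - \sum_(k | k != i) info_offdiag Y i k
                 else info_offdiag Y i j.

(* Trajectories are taken on the whole time line: every trajectory on [0, +oo[
   of a linear system with constant coefficients (and, for a second-order one,
   invertible leading coefficient) extends uniquely to it. Such a system has
   exactly one trajectory for each initial condition, so "for every initial
   condition" is quantification over all trajectories. *)
Definition first_order_solution (R : realType) (m : nat) (A : 'M[R]_m)
  (z : R -> 'cV[R]_m) : Prop :=
  forall t : R, derivable z t 1 /\ z^`() t = A *m z t.

Definition semistable (R : realType) (m : nat) (A : 'M[R]_m) : Prop :=
  forall z : R -> 'cV[R]_m, first_order_solution A z ->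
    cvg (z t @[t --> +oo]).

(* M x'' + C x' + K x = 0 *)
Definition second_order_solution (R : realType) (n : nat) (M C K : 'M[R]_n)
  (x : R -> 'cV[R]_n) : Prop :=
  forall t : R, [/\ derivable x t 1, derivable x^`() t 1 &
    M *m (x^`(2) t)%classic + C *m (x^`() t)%classic + K *m x t = 0].

Definition second_order_semistable (R : realType) (n : nat)
  (M C K : 'M[R]_n) : Prop :=
  forall x : R -> 'cV[R]_n, second_order_solution M C K x ->
    cvg (x t @[t --> +oo]) /\ cvg (x^`() t @[t --> +oo]).

(* Main.v *)
(* The first-order system reads D I' + S I = Y U and U' = - Q x - T x', where
   x = Upsilon^-1 I, S = E + Y R, Q = Psi L and T = Phi L; differentiating the
   first equation and eliminating U' gives the second-order one. As Y may be
   singular, neither passage is immediate. Let P be symmetric with range ker Y,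
   so that P Y = 0; the quadratic form of Y shows ker Y <= ker L, whence
   P L = L P = 0. Since P Psi^-1 (U + T x) is constant and Y + P Psi^-1 is
   invertible, U converges as soon as x and x' do. Conversely, a second-order
   solution x lifts to a first-order one once D I' + S I lies in the range of Y;
   P (D I' + S I) is constant and vanishes after subtracting from x a constant
   x0 in ker Y, which is an equilibrium. The same invertible matrix then gives
   U without any integration. *)
Require Import Defs.
From mathcomp Require Import ring lra.

Set Implicit Arguments.
Unset Strict Implicit.
Unset Printing Implicit Defensive.

Local Open Scope ring_scope.
Local Open Scope classical_set_scope.

(** * Linear algebra: symmetric matrices and their kernels *)

Lemma unitmx_ker0 (F : fieldType) n (A : 'M[F]_n) :
  (forall u : 'cV_n, A *m u = 0 -> u = 0) -> A \in unitmx.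
Proof.
move=> A0; rewrite -unitmx_tr -row_free_unit -kermx_eq0.
apply/rowV0P => v /sub_kermxP vA; apply: (can_inj trmxK); rewrite trmx0.
by apply: A0; apply: (can_inj trmxK); rewrite trmx_mul trmxK trmx0.
Qed.

Lemma diag_form_eq0 (R : realDomainType) n (d : 'rV[R]_n) (u : 'cV[R]_n) :
  (forall k, 0 < d 0 k) -> u^T *m diag_mx d *m u = 0 -> u = 0.
Proof.
move=> d0 /matrixP/(_ 0 0); rewrite -mulmxA mul_diag_mx !mxE => /eqP.
rewrite psumr_eq0 => [/allP u0|k _].
  apply/matrixP => k j; rewrite ord1.
  have := u0 k (mem_index_enum k); rewrite !mxE !mulf_eq0 (gt_eqF (d0 k)) /=.
  by rewrite orbb => /eqP.
by rewrite !mxE mulrCA mulr_ge0 ?(ltW (d0 k))// -expr2 sqr_ge0.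
Qed.

(** Pairing the hypothesis with [u] gives the squared Euclidean norm of [A *m u]. For symmetric [P]
    this yields that [P *m (P *m u) = 0] forces [P *m u = 0]. *)
Lemma gram_eq0 (R : realFieldType) m n (A : 'M[R]_(m, n)) (u : 'cV[R]_n) :
  A^T *m (A *m u) = 0 -> A *m u = 0.
Proof.
move=> Au0; apply: (@diag_form_eq0 _ _ (const_mx 1)) => [k|].
  by rewrite mxE.
by rewrite diag_const_mx mulmx1 trmx_mul -mulmxA Au0 mulmx0.
Qed.

Section symmetric_kernel.
Context {R : realFieldType} {n : nat} (Y : 'M[R]_n).
Hypothesis Y_sym : Y^T = Y.

Lemma sym_kernel_range :
  exists P : 'M[R]_n, [/\ P^T = P, P *m Y = 0 &
    forall u : 'cV_n, Y *m u = 0 -> exists a : 'cV_n, u = P *m a].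
Proof.
(* The rows of [K] span the kernel of [Y]; [P] need not be a projection, as only its symmetry and
   range matter. *)
pose K := kermx Y; pose P := K^T *m K.
have PT : P^T = P by rewrite trmx_mul trmxK.
have PY : P *m Y = 0 by rewrite -mulmxA mulmx_ker mulmx0.
(* A vector [u] killed by [Y + P] is killed by [P] (multiply by [P]), hence by [Y] and by [K]; being
   a combination of the rows of [K], it is orthogonal to itself. *)
have YPu : Y + P \in unitmx.
  apply: unitmx_ker0 => u; rewrite mulmxDl => YPu0.
  have Pu0 : P *m u = 0.
    apply: gram_eq0; rewrite PT -[RHS](mulmx0 _ P) -[in RHS]YPu0.
    by rewrite mulmxDr [P *m (Y *m _)]mulmxA PY mul0mx add0r.
  move: YPu0; rewrite Pu0 addr0 => Yu0.
  have Ku0 : K *m u = 0 by apply: gram_eq0; rewrite mulmxA.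
  have /sub_kermxP/submxP[b ub] : u^T *m Y = 0.
    by rewrite -Y_sym -trmx_mul Yu0 trmx0.
  apply: (@diag_form_eq0 _ _ (const_mx 1)) => [k|]; first by rewrite mxE.
  by rewrite diag_const_mx mulmx1 ub -mulmxA Ku0 mulmx0.
exists P; split=> // u Yu0; exists (invmx (Y + P) *m u).
(* In [u = Y *m s + P *m s], applying [Y] kills [u] and the second term, so [Y *m (Y *m s) = 0] and
   the first term vanishes. *)
set s := invmx _ *m u.
have us : u = Y *m s + P *m s by rewrite -mulmxDl mulKVmx.
suff Ys0 : Y *m s = 0 by rewrite us Ys0 add0r.
have YP : Y *m P = 0 by rewrite -[LHS]trmxK trmx_mul PT Y_sym PY trmx0.
apply: gram_eq0; rewrite Y_sym -[RHS]Yu0 us mulmxDr.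
by rewrite [Y *m (P *m s)]mulmxA YP mul0mx addr0.
Qed.

(** Multiplying [(Y + P d) u = 0] by [P] gives [P d u = 0], hence [Y u = 0] and [u = P a]. Then
    [u^T d u = a^T P d u = 0], and [d] is positive definite. *)
Lemma sym_kernel_perturbation (P : 'M[R]_n) (d : 'rV[R]_n) :
  P^T = P -> P *m Y = 0 ->
  (forall u : 'cV_n, Y *m u = 0 -> exists a : 'cV_n, u = P *m a) ->
  (forall k, 0 < d 0 k) -> Y + P *m diag_mx d \in unitmx.
Proof.
move=> PT PY YP d0; apply: unitmx_ker0 => u; rewrite mulmxDl => u0.
have Pdu0 : P *m (diag_mx d *m u) = 0.
  apply: gram_eq0; rewrite PT -[RHS](mulmx0 _ P) -[in RHS]u0.
  by rewrite mulmxDr [P *m (Y *m _)]mulmxA PY mul0mx add0r -mulmxA.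
have [a ua] : exists a, u = P *m a.
  by apply: YP; move: u0; rewrite -mulmxA Pdu0 addr0.
apply: (@diag_form_eq0 _ _ d) => //.
by rewrite {1}ua trmx_mul PT -!mulmxA Pdu0 mulmx0.
Qed.

End symmetric_kernel.

(** * Conductance matrix and information Laplacian *)

Definition laplacian_mx (R : pzRingType) n (a : 'I_n -> 'I_n -> R) : 'M[R]_n :=
  \matrix_(i, j) if i == j then - \sum_(k | k != i) a i k else a i j.

(** Arbitrary weights cover both the branch matrix, with weights [- G i j], and the information
    Laplacian. *)
Lemma laplacian_mx_mulE (R : pzRingType) n (a : 'I_n -> 'I_n -> R)
    (w : 'cV[R]_n) i :
  (laplacian_mx a *m w) i 0 = \sum_j a i j * (w j 0 - w i 0).
Proof.
rewrite mxE (bigD1 i)//= [RHS](bigD1 i)//= mxE eqxx subrr mulr0 add0r.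
rewrite mulNr mulr_suml -sumrN -big_split/=; apply: eq_bigr => j ji.
by rewrite mxE eq_sym (negPf ji) mulrBr addrC.
Qed.

Section conductance.
Context {R : realType} {n : nat} (G : 'M[R]_n).
Hypothesis G_sym : forall k j, G k j = G j k.
Hypothesis G_ge0 : forall k j, 0 <= G k j.
Let Y := conductance_mx G.

Lemma conductance_mx_mulE (w : 'cV[R]_n) k :
  (Y *m w) k 0 = G k k * w k 0 + \sum_j G k j * (w k 0 - w j 0).
Proof.
rewrite /Y /conductance_mx mulmxDl mxE mul_diag_mx [X in X + _]mxE mxE.
congr (_ + _).
have -> : branch_mx G = laplacian_mx (fun i j => - G i j).
  by apply/matrixP => i j; rewrite !mxE sumrN opprK.
by rewrite laplacian_mx_mulE; apply: eq_bigr => j _; rewrite mulNr -mulrN opprB.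
Qed.

Lemma conductance_mx_offdiag k j : k != j -> Y k j = - G k j.
Proof.
by move=> kj; rewrite !mxE (negPf kj) mulr0n add0r.
Qed.

Lemma conductance_mx_sym : Y^T = Y.
Proof.
apply/matrixP => k j; rewrite mxE; have [->//|kj] := eqVneq k j.
by rewrite !conductance_mx_offdiag// 1?eq_sym// G_sym.
Qed.

Lemma info_laplacian_sym : (info_laplacian Y)^T = info_laplacian Y.
Proof.
apply/matrixP => k j; rewrite !mxE eq_sym; case: eqVneq => [->//|kj].
by rewrite /info_offdiag -{1}conductance_mx_sym mxE.
Qed.

(** The dissipated power [w^T Y w] is the sum of the [G k k * w_k^2] plus half the sum of the
    [G k j * (w_k - w_j)^2]. All terms are nonnegative, so each vanishes when [Y w = 0]. *)
Lemma conductance_mx_ker (w : 'cV[R]_n) k j :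
  Y *m w = 0 -> G k j != 0 -> w k 0 = w j 0.
Proof.
move=> Yw0 Gkj.
pose f k j := G k j * (w k 0 - w j 0) * w k 0.
(* This is [w^T Y w = 0], written out row by row. *)
have fE : \sum_k G k k * w k 0 ^+ 2 + \sum_k \sum_j f k j = 0.
  rewrite -big_split/=; apply: big1 => i _.
  have /matrixP/(_ i 0) := Yw0; rewrite conductance_mx_mulE mxE => Yw0i.
  by rewrite /f -mulr_suml expr2 mulrA -mulrDl Yw0i mul0r.
(* Exchanging the indices in one copy of the double sum and using the symmetry of [G] completes the
   square. *)
have sqE : \sum_k \sum_j G k j * (w k 0 - w j 0) ^+ 2
    = \sum_k \sum_j f k j + \sum_k \sum_j f k j.
  rewrite [X in _ + X]exchange_big/= -big_split/=; apply: eq_bigr => i _.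
  rewrite -big_split/=; apply: eq_bigr => l _; rewrite /f (G_sym l i); ring.
have sq0 i l : 0 <= G i l * (w i 0 - w l 0) ^+ 2 by rewrite mulr_ge0 ?sqr_ge0.
have sh0 : 0 <= \sum_k G k k * w k 0 ^+ 2.
  by apply: sumr_ge0 => i _; rewrite mulr_ge0 ?sqr_ge0.
have : \sum_k \sum_j G k j * (w k 0 - w j 0) ^+ 2 = 0.
  apply/eqP; rewrite eq_le; apply/andP; split; first by rewrite sqE; lra.
  by apply: sumr_ge0 => i _; exact: sumr_ge0.
move/psumr_eq0P => /(_ (fun i _ => sumr_ge0 _ (fun l _ => sq0 i l))) /(_ k isT).
move/psumr_eq0P => /(_ (fun l _ => sq0 k l)) /(_ j isT) /eqP.
by rewrite mulf_eq0 (negPf Gkj) sqrf_eq0 subr_eq0 => /eqP.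
Qed.

(** Edges of the information graph are the branches with nonzero conductance, and [w] takes equal
    values at the two ends of each. *)
Lemma conductance_mx_ker_laplacian (w : 'cV[R]_n) :
  Y *m w = 0 -> info_laplacian Y *m w = 0.
Proof.
move=> Yw0; apply/matrixP => i j.
rewrite ord1 (laplacian_mx_mulE (info_offdiag Y)) mxE; apply: big1 => l _.
have [->|il] := eqVneq i l; first by rewrite subrr mulr0.
rewrite /info_offdiag conductance_mx_offdiag// oppr_eq0.
case: ifPn => [Gil|_]; last by rewrite mul0r.
by rewrite (conductance_mx_ker Yw0 Gil) subrr mulr0.
Qed.

End conductance.

(** * Limits and derivatives of vector-valued trajectories *)

Lemma cvg_mx (R : realType) (T : Type) (F : set_system T) (FF : Filter F) m n
    (f : T -> 'M[R]_(m, n)) (l : 'M[R]_(m, n)) :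
  (forall i j, f x i j @[x --> F] --> l i j) -> f x @[x --> F] --> l.
Proof.
move=> fl A [B lB sBA].
have : \forall x \near F, forall i j, B i j (f x i j).
  by apply: filter_forall => i; apply: filter_forall => j; exact: fl (lB i j).
by apply: filterS => x Bx; apply: sBA.
Qed.

Lemma mulmx_continuous (R : realType) m n p (A : 'M[R]_(m, n)) :
  continuous (fun B : 'M[R]_(n, p) => A *m B).
Proof.
move=> B; apply: (@cvg_mx _ _ (nbhs B)) => i j; rewrite mxE.
under eq_fun do rewrite mxE.
apply: cvg_big => [|k _]; first exact: add_continuous.
by apply: cvgM; [exact: cvg_cst|exact: coord_continuous].
Qed.

Section mulmx_trajectory.
Context {R : realType} {m n p : nat}.
Implicit Types (A : 'M[R]_(m, n)) (z : R -> 'M[R]_(n, p)).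

Lemma cvg_mulmx A {T : Type} (F : set_system T) (FF : Filter F)
    (f : T -> 'M[R]_(n, p)) l :
  f t @[t --> F] --> l -> A *m f t @[t --> F] --> A *m l.
Proof.
by move=> fl; apply: (cvg_comp f (mulmx A) fl); exact: mulmx_continuous.
Qed.

(** Multiplication by [A] commutes with the difference quotient and, being continuous, with its
    limit. *)
Lemma is_derive_mulmx A z (t : R) dz :
  is_derive t 1 z dz -> is_derive t 1 (fun s => A *m z s) (A *m dz).
Proof.
move=> [dzt <-].
have qE : (fun h : R =>
      h^-1 *: (((fun s => A *m z s) \o shift t) (h *: 1) - A *m z t))
    = (fun h => A *m (h^-1 *: ((z \o shift t) (h *: 1) - z t))).
  by apply/funext => h /=; rewrite -scalemxAr mulmxBr.
have lq : A *m (h^-1 *: ((z \o shift t) (h *: 1) - z t)) @[h --> 0^'] -->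
    A *m 'D_1 z t.
  exact: cvg_mulmx.
split; first by apply/cvg_ex; exists (A *m 'D_1 z t); rewrite qE.
by rewrite /derive qE; exact: cvg_lim lq.
Qed.

Lemma derive0_cst z :
  (forall t : R, is_derive t (1 : R) z 0) -> forall s t, z s = z t.
Proof.
move=> dz s t; apply/matrixP => i j.
apply: (is_derive_0_is_cst (f := fun u => z u i j)) => u.
have [du du0] := dz u.
split; first by move/derivable_mxP : du; apply.
by move: du0; rewrite derive_mx// => /matrixP/(_ i j); rewrite !mxE.
Qed.

End mulmx_trajectory.

Section trajectories.
Context {R : realType}.

Lemma is_derive_addfun n (f g df dg : R -> 'cV[R]_n) :
  (forall t : R, is_derive t 1 f (df t)) ->
  (forall t : R, is_derive t 1 g (dg t)) ->
  forall t : R, is_derive t 1 (fun s => f s + g s) (df t + dg t).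
Proof. by move=> Hf Hg t; apply: is_deriveD. Qed.

Lemma is_derive_mulfun m n (A : 'M[R]_(m, n)) (f df : R -> 'cV[R]_n) :
  (forall t : R, is_derive t 1 f (df t)) ->
  forall t : R, is_derive t 1 (fun s => A *m f s) (A *m df t).
Proof. by move=> Hf t; apply: is_derive_mulmx. Qed.

Lemma is_derive_addcst n (f df : R -> 'cV[R]_n) (c : 'cV[R]_n) :
  (forall t : R, is_derive t 1 f (df t)) ->
  forall t : R, is_derive t 1 (fun s => f s + c) (df t).
Proof.
move=> Hf t; rewrite -[df t]addr0.
by apply: (is_derive_addfun (g := cst c) (dg := cst 0)).
Qed.

Definition converges n (f : R -> 'cV[R]_n) :=
  exists l : 'cV[R]_n, f t @[t --> +oo] --> l.

Lemma convergesE n (f : R -> 'cV[R]_n) :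
  cvg (f t @[t --> +oo]) <-> converges f.
Proof. by split=> /cvg_ex. Qed.

Lemma converges_mul m n (A : 'M[R]_(m, n)) (f : R -> 'cV[R]_n) :
  converges f -> converges (fun t => A *m f t).
Proof. by move=> [l fl]; exists (A *m l); exact: cvg_mulmx. Qed.

Lemma converges_add n (f g : R -> 'cV[R]_n) :
  converges f -> converges g -> converges (fun t => f t + g t).
Proof. by move=> [l fl] [k gk]; exists (l + k); exact: cvgD. Qed.

Lemma converges_addcst n (f : R -> 'cV[R]_n) (c : 'cV[R]_n) :
  converges f -> converges (fun t => f t + c).
Proof. by move=> Hf; apply: (converges_add Hf); exists c; exact: cvg_cst. Qed.

Lemma eq_converges_mul m n (A : 'M[R]_(m, n)) (f : R -> 'cV[R]_n)
    (g : R -> 'cV[R]_m) :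
  (forall t, A *m f t = g t) -> converges f -> converges g.
Proof. by move=> /funext <-; exact: converges_mul. Qed.

Lemma derive1_fun n (f df : R -> 'cV[R]_n) :
  (forall t : R, is_derive t 1 f (df t)) -> f^`() = df.
Proof. by move=> Hf; apply/funext => t; rewrite derive1E; have [_] := Hf t. Qed.

Lemma derive1_is_derive n (f : R -> 'cV[R]_n) :
  (forall t, derivable f t 1) -> forall t : R, is_derive t 1 f (f^`() t).
Proof. by move=> Hf t; rewrite derive1E; apply/derivableP. Qed.

Lemma first_order_solutionP n (A : 'M[R]_n) z :
  first_order_solution A z <-> forall t : R, is_derive t 1 z (A *m z t).
Proof.
split=> Hz t; last by have [? ?] := Hz t; rewrite derive1E.
by have [zt <-] := Hz t; apply: derive1_is_derive => s; have [] := Hz s.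
Qed.

(** Velocity and acceleration become explicit functions, so that iterated derivatives need not be
    manipulated. *)
Lemma second_order_solutionP n (M C K : 'M[R]_n) x :
  second_order_solution M C K x <-> exists v a : R -> 'cV[R]_n,
    [/\ forall t : R, is_derive t 1 x (v t),
      forall t : R, is_derive t 1 v (a t) &
      forall t, M *m a t + C *m v t + K *m x t = 0].
Proof.
split=> [Hx|[v [a [Hv Ha Hx]]] t].
  exists x^`(), (x^`()^`()); split=> t; last by have [_ _] := Hx t.
    by apply: derive1_is_derive => s; have [] := Hx s.
  by apply: derive1_is_derive => s; have [] := Hx s.
have xv := derive1_fun Hv; have va := derive1_fun Ha.
have x2 : x^`(2) = a by rewrite derive1nS derive1n1 xv va.
rewrite x2 xv; split; [by have [] := Hv t|by have [] := Ha t|exact: Hx].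
Qed.

(** Stacking, like the two projections below, is expressed by matrix products, so the rules for
    linear maps give derivatives and limits blockwise. *)
Lemma col_mxE m n (u : 'cV[R]_m) (v : 'cV[R]_n) :
  col_mx u v = col_mx 1%:M 0 *m u + col_mx 0 1%:M *m v.
Proof. by rewrite !mul_col_mx !mul1mx !mul0mx add_col_mx addr0 add0r. Qed.

Lemma usubmxE m n (z : 'cV[R]_(m + n)) : usubmx z = row_mx 1%:M 0 *m z.
Proof. by rewrite -[z in RHS]vsubmxK mul_row_col mul1mx mul0mx addr0. Qed.

Lemma dsubmxE m n (z : 'cV[R]_(m + n)) : dsubmx z = row_mx 0 1%:M *m z.
Proof. by rewrite -[z in RHS]vsubmxK mul_row_col mul1mx mul0mx add0r. Qed.

Lemma is_derive_col_mx m n (f df : R -> 'cV[R]_m) (g dg : R -> 'cV[R]_n) :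
  (forall t : R,
    is_derive t 1 (fun s => col_mx (f s) (g s)) (col_mx (df t) (dg t))) <->
  (forall t : R, is_derive t 1 f (df t)) /\
  (forall t : R, is_derive t 1 g (dg t)).
Proof.
split=> [H|[Hf Hg] t].
  split=> t.
    have := is_derive_mulfun (row_mx 1%:M 0) H t.
    under eq_fun do rewrite -usubmxE col_mxKu.
    by rewrite -usubmxE col_mxKu.
  have := is_derive_mulfun (row_mx 0 1%:M) H t.
  under eq_fun do rewrite -dsubmxE col_mxKd.
  by rewrite -dsubmxE col_mxKd.
under eq_fun do rewrite col_mxE.
rewrite col_mxE.
exact: (is_derive_addfun (is_derive_mulfun _ Hf) (is_derive_mulfun _ Hg)).
Qed.

Lemma converges_col_mx m n (f : R -> 'cV[R]_m) (g : R -> 'cV[R]_n) :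
  converges (fun t => col_mx (f t) (g t)) <-> converges f /\ converges g.
Proof.
split=> [H|[Hf Hg]].
  by split; [apply: (eq_converges_mul (A := row_mx 1%:M 0)) H => t|
             apply: (eq_converges_mul (A := row_mx 0 1%:M)) H => t];
     rewrite -?usubmxE -?dsubmxE ?col_mxKu ?col_mxKd.
under eq_fun do rewrite col_mxE.
exact: (converges_add (converges_mul _ Hf) (converges_mul _ Hg)).
Qed.

End trajectories.

(** * Passage between the first-order and second-order systems *)

Section reduction.
Context {R : realType} {n : nat} (Y D Ups S T Q P W : 'M[R]_n).
Hypothesis D_unit : D \in unitmx.
Hypothesis Ups_unit : Ups \in unitmx.
Hypothesis PY : P *m Y = 0.
Hypothesis PS : P *m S = P.
Hypothesis QP : Q *m P = 0.
Hypothesis PWQ : P *m W *m Q = 0.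
Hypothesis P_inj : forall u : 'cV[R]_n, P *m (P *m u) = 0 -> P *m u = 0.
Hypothesis YPW_unit : Y + P *m W \in unitmx.
Hypothesis YUP_unit : Y + Ups *m P \in unitmx.

(** The matrix of the first-order system, with [S = E + Y R], [T = Phi L] and [Q = Psi L]; [W]
    stands for the inverse of [Psi]. *)
Let A := block_mx
  (- (invmx D *m S)) (invmx D *m Y)
  (- (Q *m invmx Ups) + T *m invmx Ups *m invmx D *m S)
  (- (T *m invmx Ups *m invmx D *m Y)).

(** The second block row contains [D^-1 (Y U - S I)], which is [dI] by the first row; this
    substitution removes [U] from it. *)
Lemma block_mulE (I U dI dU : 'cV[R]_n) :
  A *m col_mx I U = col_mx dI dU <->
  D *m dI + S *m I = Y *m U /\
  dU = - (Q *m (invmx Ups *m I)) - T *m (invmx Ups *m dI).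
Proof.
have -> : A *m col_mx I U = col_mx (invmx D *m (Y *m U - S *m I))
    (- (Q *m (invmx Ups *m I))
     - T *m (invmx Ups *m (invmx D *m (Y *m U - S *m I)))).
  rewrite mul_block_col; congr col_mx.
    by rewrite mulNmx mulmxBr !mulmxA addrC.
  by rewrite mulmxDl !mulNmx !mulmxBr opprB !mulmxA addrA.
split=> [/eq_col_mx[<- <-]|[dIE ->]].
  by rewrite mulKVmx// subrK.
by rewrite -dIE addrK mulKmx.
Qed.

Lemma semistable_of_second_order :
  second_order_semistable (D *m Ups) (S *m Ups + Y *m T) (Y *m Q) ->
  semistable A.
Proof.
move=> semi z /first_order_solutionP dz.
pose I t := usubmx (z t); pose U t := dsubmx (z t).
pose dI t := usubmx (A *m z t); pose dU t := dsubmx (A *m z t).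
have zE t : z t = col_mx (I t) (U t) by rewrite vsubmxK.
have AzE t : A *m z t = col_mx (dI t) (dU t) by rewrite vsubmxK.
have [HI HU] : (forall t : R, is_derive t 1 I (dI t)) /\
    (forall t : R, is_derive t 1 U (dU t)).
  apply/is_derive_col_mx => t; rewrite -AzE.
  by under eq_fun do rewrite -zE.
have sys t : D *m dI t + S *m I t = Y *m U t /\
    dU t = - (Q *m (invmx Ups *m I t)) - T *m (invmx Ups *m dI t).
  by apply/block_mulE; rewrite -zE.
have dIE t : dI t = invmx D *m Y *m U t + - (invmx D *m S) *m I t.
  by rewrite mulNmx -[_ *m U t]mulmxA -(sys t).1 mulmxDr mulKmx// mulmxA addrK.
(* [I] is twice differentiable because [dI] is a fixed linear combination of [U] and [I]. *)
pose ddI t := invmx D *m Y *m dU t + - (invmx D *m S) *m dI t.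
have HdI (t : R) : is_derive t 1 dI (ddI t).
  rewrite (_ : dI = fun t => invmx D *m Y *m U t + - (invmx D *m S) *m I t).
    exact: (is_derive_addfun (is_derive_mulfun _ HU) (is_derive_mulfun _ HI)).
  exact/funext.
have [Ic dIc] : converges I /\ converges dI.
  pose x t := invmx Ups *m I t.
  have Hx (t : R) : is_derive t 1 x (invmx Ups *m dI t).
    exact: is_derive_mulfun.
  have /semi[/convergesE xc] : second_order_solution
      (D *m Ups) (S *m Ups + Y *m T) (Y *m Q) x.
    apply/second_order_solutionP.
    exists (fun t => invmx Ups *m dI t), (fun t => invmx Ups *m ddI t).
    split=> // t.
      exact: is_derive_mulfun.
    have [_ dUE] := sys t.
    rewrite /ddI mulmxDl -!(mulmxA _ Ups) !mulKVmx// mulmxDr !mulNmx mulmxN.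
    rewrite -!mulmxA !mulKVmx// dUE mulmxBr mulmxN /x.
    set a := Y *m (Q *m _); set b := Y *m (T *m _); set c := S *m _.
    by rewrite -[- a - b - c]addrA -opprD [b + c]addrC subrK addNr.
  rewrite (derive1_fun Hx) => /convergesE vc; split.
    by apply: (eq_converges_mul (A := Ups)) xc => t; rewrite mulKVmx.
  by apply: (eq_converges_mul (A := Ups)) vc => t; rewrite mulKVmx.
have YUc : converges (fun t => Y *m U t).
  under eq_fun do rewrite -(sys _).1.
  exact: (converges_add (converges_mul _ dIc) (converges_mul _ Ic)).
(* Conserved quantity: the derivative of [U + T x] is [- Q x], which [P *m W] annihilates. *)
have PUcst t : P *m W *m (U t + T *m invmx Ups *m I t)
    = P *m W *m (U 0 + T *m invmx Ups *m I 0).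
  apply: (derive0_cst (z := fun t => P *m W *m (U t + T *m invmx Ups *m I t))).
  move=> s.
  rewrite (_ : 0 = P *m W *m (dU s + T *m invmx Ups *m dI s)).
    exact: (is_derive_mulfun _ (is_derive_addfun HU (is_derive_mulfun _ HI))).
  have [_ ->] := sys s; rewrite -[T *m _ *m _]mulmxA subrK.
  by rewrite mulmxN mulmxA PWQ mul0mx oppr0.
have Uc : converges U.
  pose c := P *m W *m (U 0 + T *m invmx Ups *m I 0).
  (* [(Y + P W) U] splits into [Y U], known to converge, and [P W U], which the conserved quantity
     expresses through [I]. *)
  have UE t : U t = invmx (Y + P *m W) *m
      (Y *m U t + (- (P *m W *m (T *m invmx Ups)) *m I t + c)).
    rewrite /c -(PUcst t) [P *m W *m (_ + _)]mulmxDr mulNmx.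
    rewrite [P *m W *m (_ *m I t)]mulmxA [- _ + _]addrC addrK.
    by rewrite -mulmxDl mulKmx.
  rewrite (funext UE).
  apply: converges_mul; apply: (converges_add YUc).
  exact: (converges_addcst _ (converges_mul _ Ic)).
by apply/convergesE; rewrite (funext zE); exact/converges_col_mx.
Qed.

Lemma second_order_of_semistable :
  semistable A ->
  second_order_semistable (D *m Ups) (S *m Ups + Y *m T) (Y *m Q).
Proof.
move=> semi x /second_order_solutionP[v [a [Hx Hv sys]]].
(* [b0] is [D I' + S I] for [I = Ups x], the candidate for [Y U]; the second-order equation makes
   its derivative [db] lie in the range of [Y]. *)
pose b0 t := D *m Ups *m v t + S *m Ups *m x t.
pose db t := - (Y *m T) *m v t + - (Y *m Q) *m x t.
have Hb0 (t : R) : is_derive t 1 b0 (db t).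
  rewrite (_ : db t = D *m Ups *m a t + S *m Ups *m v t).
    exact: (is_derive_addfun (is_derive_mulfun _ Hv) (is_derive_mulfun _ Hx)).
  have /eqP := sys t; rewrite mulmxDl addrA.
  rewrite -[_ + _ + Y *m Q *m _]addrA addr_eq0 => /eqP ->.
  by rewrite /db opprD !mulNmx.
have Pb0 t : P *m b0 t = P *m b0 0.
  apply: (derive0_cst (z := fun t => P *m b0 t)) => s.
  rewrite (_ : 0 = P *m db s); first exact: is_derive_mulfun.
  by rewrite mulmxDr !mulNmx !mulmxN !mulmxA PY !mul0mx oppr0 addr0.
(* The shift [x0] must satisfy [P S Ups x0 = P b0], that is [P Ups x0 = P b0] as [P S = P]. Applying
   [P] to [(Y + Ups P) w = b0 0] shows that [x0 = P w] does. *)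
pose w := invmx (Y + Ups *m P) *m b0 0; pose x0 := P *m w.
have Pw : P *m (Ups *m x0) = P *m b0 0.
  rewrite -[b0 0](mulKVmx YUP_unit) -/w mulmxDl mulmxDr [P *m (Y *m w)]mulmxA.
  by rewrite PY mul0mx add0r /x0 -!mulmxA.
pose x1 t := x t - x0.
have Hx1 (t : R) : is_derive t 1 x1 (v t) by exact: is_derive_addcst.
pose b t := b0 t - S *m (Ups *m x0).
have Hb (t : R) : is_derive t 1 b (db t) by exact: is_derive_addcst.
have bE t : b t = D *m (Ups *m v t) + S *m (Ups *m x1 t).
  by rewrite /b /b0 /x1 !mulmxBr !mulmxA addrA.
have Pb t : P *m b t = 0.
  by rewrite mulmxBr Pb0 [P *m (S *m _)]mulmxA PS Pw subrr.
pose Z := Y + P *m W.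
(* [U] solves at once [Y U = b] and [P W (U + T x1) = 0]: their sum is the equation
   [Z U = b - P W T x1], separated again below. *)
pose U t := invmx Z *m (b t + - (P *m W *m T) *m x1 t).
have HU (t : R) : is_derive t 1 U (invmx Z *m (db t + - (P *m W *m T) *m v t)).
  exact: (is_derive_mulfun _ (is_derive_addfun Hb (is_derive_mulfun _ Hx1))).
have Qx1 t : Q *m x1 t = Q *m x t.
  by rewrite /x1 mulmxBr /x0 [Q *m (P *m _)]mulmxA QP mul0mx subr0.
have dUE t : invmx Z *m (db t + - (P *m W *m T) *m v t)
    = - (Q *m x1 t) - T *m v t.
  (* After multiplication by [Z] both sides agree, since [P W Q = 0] and [Q x1 = Q x]. *)
  apply: (can_inj (mulKmx YPW_unit)); rewrite mulKVmx// Qx1 /db.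
  rewrite mulmxBr mulmxN !mulmxDl !mulmxA PWQ mul0mx addr0 !mulNmx.
  by rewrite opprD addrA [- _ + - _ in LHS]addrC.
have YU t : Y *m U t = b t.
  have ZU : Y *m U t + P *m (W *m (U t + T *m x1 t)) = b t.
    rewrite 2!mulmxDr addrA ![P *m (W *m _)]mulmxA -mulmxDl mulKVmx// mulNmx.
    by rewrite [_ *m (T *m _)]mulmxA subrK.
  (* Applying [P] to the sum kills [Y U] and [b], leaving [P P W (U + T x1) = 0]. *)
  have : P *m (P *m (W *m (U t + T *m x1 t))) = 0.
    rewrite -(Pb t) -ZU [in RHS]mulmxDr [P *m (Y *m _)]mulmxA PY mul0mx.
    by rewrite add0r.
  by move/P_inj => PWU; rewrite -ZU PWU addr0.
have : first_order_solution A (fun t => col_mx (Ups *m x1 t) (U t)).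
  apply/first_order_solutionP => t.
  have -> : A *m col_mx (Ups *m x1 t) (U t) =
      col_mx (Ups *m v t) (- (Q *m x1 t) - T *m v t).
    by apply/block_mulE; rewrite !mulKmx// YU bE.
  move: t; apply/is_derive_col_mx; split=> t; first exact: is_derive_mulfun.
  by rewrite -dUE.
move/semi/convergesE/converges_col_mx => [Uxc Uc].
have x1c : converges x1.
  by apply: (eq_converges_mul (A := invmx Ups)) Uxc => t; rewrite mulKmx.
rewrite (derive1_fun Hx); split; apply/convergesE.
  rewrite (_ : x = fun t => x1 t + x0).
    exact: converges_addcst.
  by apply/funext => t; rewrite subrK.
(* The first-order state holds no velocity; the first equation recovers it from [U] and [x1]. *)
have vE t : v t = invmx (D *m Ups) *m (Y *m U t + - (S *m Ups) *m x1 t).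
  rewrite YU bE mulNmx !mulmxA addrK mulKmx//.
  by rewrite unitmx_mul D_unit.
rewrite (funext vE).
apply: converges_mul.
exact: (converges_add (converges_mul _ Uc) (converges_mul _ x1c)).
Qed.

End reduction.

(** * Application to the microgrid matrices *)

Lemma diag_mx_unit (F : fieldType) n (d : 'rV[F]_n) :
  (forall k, d 0 k != 0) -> diag_mx d \in unitmx.
Proof.
by move=> d0; rewrite unitmxE det_diag unitfE; apply/prodf_neq0 => k _.
Qed.

Theorem lemma3 (R : realType) (n : nat) (G : 'M[R]_n)
  (tau r Imax alpha beta : 'rV[R]_n)
  (G_sym : forall k j : 'I_n, G k j = G j k)
  (G_ge0 : forall k j : 'I_n, 0 <= G k j)
  (tau_gt0 : forall k : 'I_n, 0 < tau 0 k)
  (r_gt0 : forall k : 'I_n, 0 < r 0 k)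
  (Imax_gt0 : forall k : 'I_n, 0 < Imax 0 k)
  (alpha_gt0 : forall k : 'I_n, 0 < alpha 0 k)
  (beta_gt0 : forall k : 'I_n, 0 < beta 0 k) :
  let Y := conductance_mx G in
  let L := info_laplacian Y in
  let E : 'M[R]_n := 1%:M in
  let D := diag_mx tau in
  let Rv := diag_mx r in
  let Upsilon := diag_mx Imax in
  let Phi := diag_mx alpha in
  let Psi := diag_mx beta in
  semistable
    (block_mx
      (- (invmx D *m (E + Y *m Rv)))
      (invmx D *m Y)
      (- (Psi *m L *m invmx Upsilon)
        + Phi *m L *m invmx Upsilon *m invmx D *m (E + Y *m Rv))
      (- (Phi *m L *m invmx Upsilon *m invmx D *m Y)))
  <->
  second_order_semistable
    (D *m Upsilon)
    (Upsilon + Y *m Rv *m Upsilon + Y *m Phi *m L)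
    (Y *m Psi *m L).
Proof.
move=> Y L E D Rv Upsilon Phi Psi.
have Y_sym : Y^T = Y := conductance_mx_sym G_sym.
have [P [PT PY kerY]] := sym_kernel_range Y_sym.
have YP : Y *m P = 0 by rewrite -[LHS]trmxK trmx_mul PT Y_sym PY trmx0.
(* Each column of [P] lies in the kernel of [Y], hence in that of [L]. *)
have LP : L *m P = 0.
  apply/matrixP => i j; have Ycol : Y *m col j P = 0.
    by rewrite colE mulmxA YP mul0mx.
  have /matrixP/(_ i 0) := conductance_mx_ker_laplacian G_sym G_ge0 Ycol.
  by rewrite colE mulmxA -colE !mxE.
have PL : P *m L = 0.
  by rewrite -[LHS]trmxK trmx_mul PT (info_laplacian_sym G_sym) LP trmx0.
pose d := map_mx GRing.inv beta; pose W := diag_mx d.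
have WPsi : W *m Psi = 1%:M.
  rewrite mulmx_diag -diag_const_mx; congr diag_mx; apply/rowP => k.
  by rewrite !mxE mulVf// gt_eqF.
have D_unit : D \in unitmx by apply: diag_mx_unit => k; rewrite gt_eqF.
have Ups_unit : Upsilon \in unitmx by apply: diag_mx_unit => k; rewrite gt_eqF.
have PS : P *m (E + Y *m Rv) = P.
  by rewrite mulmxDr mulmx1 mulmxA PY mul0mx addr0.
have QP : Psi *m L *m P = 0 by rewrite -mulmxA LP mulmx0.
have PWQ : P *m W *m (Psi *m L) = 0.
  by rewrite -mulmxA [W *m _]mulmxA WPsi mul1mx.
have P_inj (u : 'cV[R]_n) : P *m (P *m u) = 0 -> P *m u = 0.
  by move=> PPu; apply: gram_eq0; rewrite PT.
have YPW_unit : Y + P *m W \in unitmx.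
  by apply: sym_kernel_perturbation => // k; rewrite mxE invr_gt0.
have YUP_unit : Y + Upsilon *m P \in unitmx.
  (* Transposing turns [Y + Upsilon P] into [Y + P Upsilon], the form of the perturbation lemma. *)
  rewrite -unitmx_tr linearD/= trmx_mul PT tr_diag_mx Y_sym.
  exact: sym_kernel_perturbation.
have -> : Upsilon + Y *m Rv *m Upsilon + Y *m Phi *m L
    = (E + Y *m Rv) *m Upsilon + Y *m (Phi *m L).
  by rewrite [(E + _) *m _]mulmxDl mul1mx mulmxA.
rewrite -[Y *m Psi *m L]mulmxA.
split.
  exact: (second_order_of_semistable (P := P) (W := W)).
by apply: (semistable_of_second_order (P := P) (W := W)).
Qed.
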